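(* Let $K$ be a field, let $d\ge0$ be an integer, and suppose $x,y\in K^*$ satisfy $x^m\ne y^m$ for all integers $1\le m\le d$. For nonnegative integers $i,j$ with $i+j\le d$ put $$P_{ij}=\left(\frac{x^i-y^i}{x^i},\ \frac{x^j-y^j}{y^j}\right)\in K^2.$$ Then there exist polynomials $f_{ij}\in K[X,Y]$, one for each pair of nonnegative integers $(i,j)$ with $i+j\le d$, each of degree at most $d$, such that $f_{ij}(P_{ij})\ne0$ for all such $(i,j)$ and $f_{ij}(P_{kl})=0$ whenever $(k,l)\ne(i,j)$ (with $k,l\ge0$, $k+l\le d$); and $\{f_{ij}: i,j\ge0,\ i+j\le d\}$ is a minimal generating set, of size $\binom{d+2}{2}$, of the ideal $I\subset K[X,Y]$ it generates.
   Context: $K^*$ is the multiplicative group of nonzero elements of $K$. A set $S\subset K[X,Y]$ is called a minimal generating set of the ideal $I=(S)$ if no proper subset of $S$ generates $I$. Degree means total degree. The points $P_{ij}$ are the ''evaluation points'': using evaluation points means exhibiting, for each point, a polynomial of degree at most $d$ that is nonzero at that point and zero at all other points of the set. *)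

(* Defs.v *)
From HB Require Import structures.
From mathcomp Require Import all_boot all_order all_algebra.
From mathcomp Require Import boolp classical_sets functions cardinality.
From mathcomp Require Import mpoly.

Set Implicit Arguments.
Unset Strict Implicit.
Unset Printing Implicit Defensive.

Import GRing.Theory.
Local Open Scope classical_set_scope.
Local Open Scope ring_scope.

(* [idealr_closed] requires ideals to be proper, which the ideal generated by
   a set need not be; hence explicit finite sums of multiples of elements of S. *)
Definition generated_ideal (R : comNzRingType) (S : set R) : set R :=
  [set p | exists2 s : seq (R * R),
     (forall u, u \in s -> S u.2) & p = \sum_(u <- s) u.1 * u.2].

Definition minimal_generating_set (R : comNzRingType) (S I : set R) : Prop :=
  generated_ideal S = I /\
  (forall T : set R, T `<` S -> generated_ideal T <> I).

(* Coordinate 0 is the value of X, coordinate 1 the value of Y. *)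
Definition eval_point (K : fieldType) (x y : K) (i j : nat) : 2.-tuple K :=
  [tuple (x ^+ i - y ^+ i) / x ^+ i; (x ^+ j - y ^+ j) / y ^+ j].

(* Main.v *)
(** With q = y / x, the affine change of coordinates u = 1 - X, v = 1 + Y sends
    P_ij to (q^i, q^-j).  The points with i = a lie on the line u = q^a, those
    with j = b on v = q^-b, and those with i + j = s on u = q^s v.  So the
    product of the i lines u = q^a (a < i), the j lines v = q^-b (b < j) and the
    d - i - j lines u = q^s v (i + j < s <= d) has degree d and separates P_ij
    from the other points: k >= i, l >= j and (k, l) <> (i, j) force k + l > i + j.
    Evaluation at P_ij then shows that f_ij is not in the ideal generated by
    the others. *)

Require Import Defs.
From HB Require Import structures.
From mathcomp Require Import all_boot all_order all_algebra.
From mathcomp Require Import boolp classical_sets functions cardinality.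
From mathcomp Require Import mpoly.
From mathcomp Require Import zify ring.

Set Implicit Arguments.
Unset Strict Implicit.
Unset Printing Implicit Defensive.

Import GRing.Theory.
Local Open Scope classical_set_scope.
Local Open Scope ring_scope.

Lemma rmorph_generated_ideal0 (R R' : comNzRingType) (phi : {rmorphism R -> R'})
    (T : set R) :
  (forall t, T t -> phi t = 0) -> forall p, generated_ideal T p -> phi p = 0.
Proof.
move=> phiT p [s sT ->]; rewrite rmorph_sum big_seq big1 // => u /sT Tu2.
by rewrite rmorphM (phiT _ Tu2) mulr0.
Qed.

Lemma sub_generated_ideal (R : comNzRingType) (S : set R) :
  S `<=` generated_ideal S.
Proof.
move=> p Sp; exists [:: (1, p)]; last by rewrite big_seq1 mul1r.
by move=> u; rewrite inE => /eqP ->.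
Qed.

(** If [T] misses [f i], then every element of [T] is some [f j] with [j <> i], so [phi i] kills [T]
    and with it the whole ideal generated by [T]; but [phi i (f i)] is nonzero. *)
Lemma separated_minimal_generating_set (I : Type) (R R' : comNzRingType)
    (D : set I) (f : I -> R) (phi : I -> {rmorphism R -> R'}) :
  (forall i, D i -> phi i (f i) != 0) ->
  (forall i j, D i -> D j -> j <> i -> phi j (f i) = 0) ->
  minimal_generating_set (f @` D) (generated_ideal (f @` D)).
Proof.
move=> fii fij; split=> // T [TS nST] eqI; apply: nST => _ [i Di <-].
apply: contrapT => nTi; case/negP: (fii _ Di); apply/eqP.
apply: (@rmorph_generated_ideal0 _ _ (phi i) T); last first.
  by rewrite eqI; apply: sub_generated_ideal; exists i.
move=> t Tt; case: (TS t Tt) => j Dj fjt; rewrite -fjt; apply: fij => // ij.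
by apply: nTi; rewrite ij fjt.
Qed.

(** Needed for the size of the generating set: it is a set of polynomials, so it has as many
    elements as there are indices only if no two of the [f i] coincide. *)
Lemma separated_inj (I : Type) (R R' : comNzRingType)
    (D : set I) (f : I -> R) (phi : I -> {rmorphism R -> R'}) :
  (forall i, D i -> phi i (f i) != 0) ->
  (forall i j, D i -> D j -> j <> i -> phi j (f i) = 0) ->
  {in D &, injective f}.
Proof.
move=> fii fij i j /set_mem Di /set_mem Dj eqf; apply: contrapT => nij.
by case/negP: (fii _ Di); rewrite eqf fij.
Qed.

(** Both entries of such a pair are at most [d], so the pairs correspond to the 2-tuples over
    ['I_d.+1] with sum at most [d], which [card_partial_ord_partitions] counts. *)
Lemma card_pairs_leq (d : nat) :
  ([set k : nat * nat | k.1 + k.2 <= d]%N #= `I_('C(d + 2, 2)))%card.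
Proof.
pose A := finset (fun t : 2.-tuple 'I_d.+1 => \sum_(i <- t) i <= d)%N.
have cardA : #|A| = 'C(d + 2, 2).
  by rewrite addnC -card_partial_ord_partitions.
pose g (t : 2.-tuple 'I_d.+1) := (val (tnth t ord0), val (tnth t (lift ord0 ord0))).
have sumE (t : 2.-tuple 'I_d.+1) : (\sum_(i <- t) i = (g t).1 + (g t).2)%N.
  by rewrite big_tuple big_ord_recl big_ord1.
have g_inj : injective g.
  move=> t u [/val_inj e0 /val_inj e1]; apply: eq_from_tnth => i.
  by case: (unliftP ord0 i) => [j|] ->; rewrite ?(ord1 j).
pose h (r : 'I_#|A|) := g (enum_val r).
have -> : [set k : nat * nat | k.1 + k.2 <= d]%N = h @` [set: 'I_#|A|].
  apply/seteqP; split=> [[k l] /= kld|_ [r _ <-] /=]; last first.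
    by have := enum_valP r; rewrite inE sumE.
  have kd : (k < d.+1)%N by lia.
  have ld : (l < d.+1)%N by lia.
  pose t := [tuple Ordinal kd; Ordinal ld].
  have tA : t \in A by rewrite inE sumE.
  by exists (enum_rank_in tA t); rewrite // /h enum_rankK_in.
rewrite -cardA; apply: card_eq_trans (card_esym card_II).
by apply: inj_card_eq => r s _ _ /g_inj /enum_val_inj.
Qed.

(** [msize] is the total degree plus one, and 0 for the zero polynomial, so a bound [a.+1] means
    degree at most [a]. The product formula [msizeM] holds for nonzero factors, whence the case
    split. *)
Lemma msizeM_leq (n : nat) (R : idomainType) (p q : {mpoly R[n]}) (a b : nat) :
  (msize p <= a.+1)%N -> (msize q <= b.+1)%N -> (msize (p * q) <= (a + b).+1)%N.
Proof.
have [->|p0] := eqVneq p 0; first by rewrite mul0r mmeasure0.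
have [->|q0] := eqVneq q 0; first by rewrite mulr0 mmeasure0.
move=> pa qb; rewrite msizeM // -ltnS prednK.
  by rewrite -addnS -addSn; apply: leq_add.
by rewrite addn_gt0 lt0n mmeasure_poly_eq0 p0.
Qed.

Lemma msize_prod_leq (n : nat) (R : idomainType) (m : nat)
    (F : 'I_m -> {mpoly R[n]}) :
  (forall i, msize (F i) <= 2)%N -> (msize (\prod_(i < m) F i) <= m.+1)%N.
Proof.
elim: m F => [|m IHm] F F2; first by rewrite big_ord0 msize1.
rewrite big_ord_recl; apply: (msizeM_leq (F2 _)).
by apply: IHm.
Qed.

Definition affine_form (R : nzRingType) (a b c : R) : {mpoly R[2]} :=
  a *: 'X_ord0 + b *: 'X_(lift ord0 ord0) + c%:MP.

Lemma msize_affine_form (R : nzRingType) (a b c : R) :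
  (msize (affine_form a b c) <= 2)%N.
Proof.
have msizeZX (e : R) i : (msize (e *: 'X_i : {mpoly R[2]}) <= 2)%N.
  by apply: leq_trans (mmeasureZ_le _ _ _) _; rewrite msizeX mdeg1.
apply: leq_trans (mmeasureD_le _ _ _) _; rewrite geq_max mmeasureC.
rewrite (leq_trans (leq_b1 _)) // andbT.
by apply: leq_trans (mmeasureD_le _ _ _) _; rewrite geq_max !msizeZX.
Qed.

Lemma meval_affine_form (R : comNzRingType) (a b c s t : R) :
  (affine_form a b c).@[tnth [tuple s; t]] = a * s + b * t + c.
Proof. by rewrite !mevalD !mevalZ !mevalXU mevalC. Qed.

(** With u = 1 - X and v = 1 + Y the factors are q^a - u, v - q^-b and q^t v - u, where t = i + j +
    s + 1 runs from i + j + 1 to d. *)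
Definition separator (K : fieldType) (q : K) (d i j : nat) : {mpoly K[2]} :=
  (\prod_(a < i) affine_form 1 0 (q ^+ a - 1)) *
  (\prod_(b < j) affine_form 0 1 (1 - q ^- b)) *
  (\prod_(s < d - (i + j))
     affine_form 1 (q ^+ (i + j + s.+1)) (q ^+ (i + j + s.+1) - 1)).

Lemma msize_separator (K : fieldType) (q : K) (d i j : nat) :
  (i + j <= d)%N -> (msize (separator q d i j) <= d.+1)%N.
Proof.
move=> /subnKC {2}<-; apply: msizeM_leq; first apply: msizeM_leq.
all: by apply: msize_prod_leq => s; apply: msize_affine_form.
Qed.

Lemma eval_pointE (K : fieldType) (x y : K) (i j : nat) :
  x != 0 -> y != 0 ->
  eval_point x y i j = [tuple 1 - (y / x) ^+ i; (y / x) ^- j - 1].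
Proof.
move=> x0 y0; rewrite /eval_point !mulrBl !divff ?expf_neq0 //.
by rewrite -!exprVn invf_div !exprMn !exprVn.
Qed.

Lemma meval_separator (K : fieldType) (q : K) (d i j k l : nat) :
  (separator q d i j).@[tnth [tuple 1 - q ^+ k; q ^- l - 1]] =
  (\prod_(a < i) (q ^+ a - q ^+ k)) * (\prod_(b < j) (q ^- l - q ^- b)) *
  (\prod_(s < d - (i + j)) (q ^+ (i + j + s.+1) / q ^+ l - q ^+ k)).
Proof.
rewrite !mevalM !rmorph_prod /=.
by congr (_ * _ * _); apply: eq_bigr => s _; rewrite meval_affine_form; ring.
Qed.

Lemma meval_separator_eq0 (K : fieldType) (q : K) (d i j k l : nat) :
  q != 0 -> (k + l <= d)%N -> (k, l) <> (i, j) ->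
  (separator q d i j).@[tnth [tuple 1 - q ^+ k; q ^- l - 1]] = 0.
Proof.
move=> q0 kld nkl; rewrite meval_separator.
have [ki|ik] := ltnP k i; first by rewrite (bigD1 (Ordinal ki)) //= subrr !mul0r.
have [lj|jl] := ltnP l j.
  by rewrite (bigD1 (Ordinal lj)) //= subrr mul0r mulr0 mul0r.
have ijkl : (i + j < k + l)%N.
  rewrite ltn_neqAle leq_add // andbT; apply/eqP => e; apply: nkl.
  by congr pair; lia.
(* This index selects the line u = q^(k+l) v, which contains the point (q^k, q^-l). *)
have sP : ((k + l - (i + j)).-1 < d - (i + j))%N by lia.
rewrite [X in _ * X](bigD1 (Ordinal sP)) //= prednK ?subn_gt0 // subnKC 1?ltnW //.
by rewrite exprD mulfK ?expf_neq0 // subrr mul0r mulr0.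
Qed.

(** The powers q^0, ..., q^d are pairwise distinct, and each factor at the point is a difference of
    two of them or of two of their inverses. *)
Lemma meval_separator_neq0 (K : fieldType) (q : K) (d i j : nat) :
  q != 0 -> (forall m, (1 <= m <= d)%N -> q ^+ m != 1) -> (i + j <= d)%N ->
  (separator q d i j).@[tnth [tuple 1 - q ^+ i; q ^- j - 1]] != 0.
Proof.
move=> q0 q1 ijd.
have qX_neq m n : (m < n <= d)%N -> q ^+ m != q ^+ n.
  move=> /andP[mn nd]; rewrite -(subnKC (ltnW mn)) exprD -{1}[q ^+ m]mulr1.
  by rewrite (inj_eq (mulfI _)) ?expf_neq0 // eq_sym q1 //; lia.
rewrite meval_separator !mulf_neq0 //; apply/prodf_neq0 => -[s sP] _ /=.
- by rewrite subr_eq0 qX_neq //; lia.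
- by rewrite subr_eq0 (inj_eq invr_inj) eq_sym qX_neq //; lia.
(* Cancelling q^j leaves q^(i+s+1) - q^i, and i + s + 1 <= d because s < d - (i + j). *)
- rewrite addnAC exprD mulfK ?expf_neq0 // subr_eq0 eq_sym qX_neq //; lia.
Qed.

Theorem theorem4p3 (K : fieldType) (d : nat) (x y : K)
    (x_neq0 : x != 0) (y_neq0 : y != 0)
    (xy_neq : forall m : nat, (1 <= m <= d)%N -> x ^+ m != y ^+ m) :
  exists f : nat -> nat -> {mpoly K[2]},
    [/\ forall i j : nat, (i + j <= d)%N -> (msize (f i j) <= d.+1)%N,
        forall i j : nat, (i + j <= d)%N ->
          (f i j).@[tnth (eval_point x y i j)] != 0,
        forall i j k l : nat, (i + j <= d)%N -> (k + l <= d)%N ->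
          (k, l) <> (i, j) -> (f i j).@[tnth (eval_point x y k l)] = 0 &
        let S : set {mpoly K[2]} :=
          [set p | exists i j : nat, (i + j <= d)%N /\ p = f i j] in
        minimal_generating_set S (generated_ideal S) /\
        (S #= `I_('C(d + 2, 2)))%card ].
Proof.
set q := y / x.
have q0 : q != 0 by rewrite mulf_neq0 ?invr_eq0.
have q1 m : (1 <= m <= d)%N -> q ^+ m != 1.
  (* Multiplying by x^m turns the claim into y^m != x^m. *)
  move=> md; rewrite expr_div_n -(inj_eq (mulIf (expf_neq0 m x_neq0))).
  by rewrite mul1r mulfVK ?expf_neq0 // eq_sym xy_neq.
pose ev (k : nat * nat) : {rmorphism {mpoly K[2]} -> K} :=
  meval (tnth (eval_point x y k.1 k.2)).
pose f (k : nat * nat) := separator q d k.1 k.2.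
pose D := [set k : nat * nat | (k.1 + k.2 <= d)%N].
have fii k : D k -> ev k (f k) != 0.
  by move=> Dk; rewrite /= eval_pointE // meval_separator_neq0.
have fij k l : D k -> D l -> l <> k -> ev l (f k) = 0.
  case: k l => [i j] [k l] Dk Dl nkl.
  by rewrite /= eval_pointE // meval_separator_eq0.
exists (separator q d); split.
- exact: msize_separator.
- by move=> i j; apply: (fii (i, j)).
- by move=> i j k l; apply: (fij (i, j) (k, l)).
have -> : [set p | exists i j : nat, (i + j <= d)%N /\ p = separator q d i j]
          = f @` D.
  apply/seteqP; split=> [p [i [j [ijd ->]]]|_ [[i j] ijd <-]].
    by exists (i, j).
  by exists i, j.
split; first exact: separated_minimal_generating_set fii fij.
apply: card_eq_trans (card_pairs_leq d).
exact: inj_card_eq (separated_inj fii fij).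
Qed.
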